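(* Let $A$ and $B$ be systems with finite-dimensional Hilbert spaces of dimensions $d_A,d_B$, and let the mediator $M$ consist of $T\ge1$ qubits. Consider a mediated Hamiltonian $\hat H=\hat H_{AM}+\hat H_{MB}$ with $$\hat H_{AM}=\sum_{i,j_1,\dots,j_T}\alpha_{i,j_1,\dots,j_T}\;a_i\otimes m_{j_1}\otimes\cdots\otimes m_{j_T}\otimes\mathbb I_B,\qquad \hat H_{MB}=\sum_{l_1,\dots,l_T,k}\beta_{l_1,\dots,l_T,k}\;\mathbb I_A\otimes m_{l_1}\otimes\cdots\otimes m_{l_T}\otimes b_k,$$ where the coefficients $\alpha,\beta$ are real. Then $$[\hat H_{AM},\hat H_{MB}]=\sum_{i,j_1,\dots,j_T,l_1,\dots,l_T,k}\alpha_{i,j_1,\dots,j_T}\,\beta_{l_1,\dots,l_T,k}\;a_i\otimes\Biggl(\sum_{r=1}^{T}\Bigl(\bigotimes_{s<r}m_{l_s}m_{j_s}\Bigr)\otimes[m_{j_r},m_{l_r}]\otimes\Bigl(\bigotimes_{s>r}m_{j_s}m_{l_s}\Bigr)\Biggr)\otimes b_k .$$ Moreover, if $[\hat H_{AM},\hat H_{MB}]\neq0$, then there exists at least one pair of mediator observables appearing in the two Hamiltonians whose commutator is non-vanishing: in the expansion above, at least one mediator commutator satisfies $[m_{j_r},m_{l_r}]\neq0$ for some mediator-qubit label $r\in\{1,\dots,T\}$, where $m_{j_r}$ and $m_{l_r}$ occur in terms of $\hat H_{AM}$ and $\hat H_{MB}$ with nonzero coefficients $\alpha_{i,j_1,\dots,j_T}\neq0$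 and $\beta_{l_1,\dots,l_T,k}\ne0$.
   Context: The $a_i$ (resp. $b_k$) are Hermitian operators on $A$ (resp. $B$) consisting of the generators of $SU(d_A)$ (resp. $SU(d_B)$) together with the identity. For each mediator qubit $r$, $m_{j_r}$ and $m_{l_r}$ range over $\{\mathbb I,X,Y,Z\}$ (identity and Pauli operators) acting on the $r$-th qubit of $M$; indices $j$ are used for $\hat H_{AM}$ and $l$ for $\hat H_{MB}$. Tensor factors are ordered as $A$, mediator qubits $1,\dots,T$, $B$. A mediator observable ''appears'' in a Hamiltonian if it occurs in a term with nonzero coefficient. *)

(* Defs.v *)
From HB Require Import structures.
From mathcomp Require Export all_boot all_order all_algebra.
From mathcomp Require Export sesquilinear reals.
From mathcomp Require Export complex mxtens.

Set Implicit Arguments.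
Unset Strict Implicit.
Unset Printing Implicit Defensive.

Import Order.TTheory GRing.Theory Num.Theory.
Local Open Scope ring_scope.
Local Open Scope complex_scope.

Definition mxcomm (K : pzRingType) (n : nat) (A B : 'M[K]_n) : 'M[K]_n :=
  A *m B - B *m A.

(* Generators of SU(d) in the physicists' convention: d^2 - 1 traceless
   Hermitian matrices forming a basis, over the reals, of the space i su(d) of
   all traceless Hermitian matrices.  No particular basis (e.g. Gell-Mann) or
   normalization is imposed. *)
Definition su_generators (R : realType) (d : nat)
    (g : 'I_(d ^ 2).-1 -> 'M[R[i]]_d) : Prop :=
  (forall k, g k \is hermsymmx /\ \tr (g k) = 0) /\
  (forall A : 'M[R[i]]_d, A \is hermsymmx -> \tr A = 0 ->
     exists! c : {ffun 'I_(d ^ 2).-1 -> R}, A = \sum_k (c k)%:C *: g k).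

Notation local_index d := (option 'I_(d ^ 2).-1).

(* Index None is the identity, index Some k is the k-th generator. *)
Definition local_op (R : realType) (d : nat) (g : 'I_(d ^ 2).-1 -> 'M[R[i]]_d)
    (i : local_index d) : 'M[R[i]]_d :=
  if i is Some k then g k else 1%:M.

Definition pauliX (R : realType) : 'M[R[i]]_2 :=
  \matrix_(x < 2, y < 2) (x != y)%:R.

Definition pauliY (R : realType) : 'M[R[i]]_2 :=
  \matrix_(x < 2, y < 2)
    (if x == y then 0 else if x == ord0 then 0 +i* (-1) else 0 +i* 1).

Definition pauliZ (R : realType) : 'M[R[i]]_2 :=
  \matrix_(x < 2, y < 2)
    (if x != y then 0 else if x == ord0 then 1 else -1).

(* Labels 0, 1, 2, 3 stand for I, X, Y, Z. *)
Definition pauli (R : realType) (p : 'I_4) : 'M[R[i]]_2 :=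
  match val p with
  | 0%N => 1%:M
  | 1%N => pauliX R
  | 2%N => pauliY R
  | _ => pauliZ R
  end.

(* f 0 *t f 1 *t ... *t f (T-1), as a matrix of size 2 ^ T. *)
Fixpoint qubit_tens (R : realType) (T : nat) :
    ('I_T -> 'M[R[i]]_2) -> 'M[R[i]]_(2 ^ T)%N :=
  match T with
  | 0%N => fun _ => 1%:M
  | T'.+1 => fun f =>
      castmx (esym (expnS 2 T'), esym (expnS 2 T'))
        (f ord0 *t qubit_tens (fun s : 'I_T' => f (lift ord0 s)))
  end.

Notation mediator_index T := {ffun 'I_T -> 'I_4}.

Definition mediator_op (R : realType) (T : nat) (j : mediator_index T) :
    'M[R[i]]_(2 ^ T)%N :=
  qubit_tens (fun s => pauli R (j s)).

(* Main.v *)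
(* The commutator of two products of single-qubit operators is a difference of
   two products, [prod_s m_j m_l - prod_s m_l m_j]; exchanging the factors one
   qubit at a time makes it telescope, each step contributing one
   single-qubit commutator. *)
Require Import Defs.
Import Order.TTheory GRing.Theory Num.Theory.
Local Open Scope ring_scope.
Local Open Scope complex_scope.

Set Implicit Arguments.
Unset Strict Implicit.
Unset Printing Implicit Defensive.

Section TensorBilinearity.
Variable R : pzRingType.

Lemma tensmxBl m n p q (A B : 'M[R]_(m, n)) (C : 'M[R]_(p, q)) :
  (A - B) *t C = A *t C - B *t C.
Proof. by apply/matrixP => x y; rewrite !mxE mulrBl. Qed.

Lemma tensmxBr m n p q (A : 'M[R]_(m, n)) (B C : 'M[R]_(p, q)) :
  A *t (B - C) = A *t B - A *t C.
Proof. by apply/matrixP => x y; rewrite !mxE mulrBr. Qed.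

Lemma tensmx_sumr I (r : seq I) (P : pred I) m n p q
    (A : 'M[R]_(m, n)) (B : I -> 'M[R]_(p, q)) :
  A *t (\sum_(i <- r | P i) B i) = \sum_(i <- r | P i) A *t B i.
Proof.
apply/matrixP => x y; rewrite !mxE !summxE mulr_sumr.
by apply: eq_bigr => i _; rewrite mxE.
Qed.

Lemma mxcomm_suml I (r : seq I) (P : pred I) n
    (A : I -> 'M[R]_n) (B : 'M[R]_n) :
  mxcomm (\sum_(i <- r | P i) A i) B = \sum_(i <- r | P i) mxcomm (A i) B.
Proof. by rewrite /mxcomm mulmx_suml mulmx_sumr -sumrB. Qed.

Lemma mxcomm_sumr I (r : seq I) (P : pred I) n
    (A : 'M[R]_n) (B : I -> 'M[R]_n) :
  mxcomm A (\sum_(i <- r | P i) B i) = \sum_(i <- r | P i) mxcomm A (B i).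
Proof. by rewrite /mxcomm mulmx_suml mulmx_sumr -sumrB. Qed.

End TensorBilinearity.

Lemma mxcommZ (R : comPzRingType) n (a b : R) (A B : 'M[R]_n) :
  mxcomm (a *: A) (b *: B) = (a * b) *: mxcomm A B.
Proof.
rewrite /mxcomm -!scalemxAl -!scalemxAr !scalerA.
by rewrite [b * a]mulrC scalerBr.
Qed.

Section QubitTensor.
Variable R : realType.

Lemma castmx_sum m n m' n' (e : (m = m') * (n = n')) I (r : seq I) (P : pred I)
    (A : I -> 'M[R[i]]_(m, n)) :
  castmx e (\sum_(i <- r | P i) A i) = \sum_(i <- r | P i) castmx e (A i).
Proof. by case: e => em en; case: m' / em; case: n' / en. Qed.

Lemma eq_qubit_tens T (f g : 'I_T -> 'M[R[i]]_2) :
  f =1 g -> qubit_tens f = qubit_tens g.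
Proof.
elim: T f g => //= T IH f g fg; rewrite fg; congr (castmx _ (_ *t _)).
by apply: IH => s; exact: fg.
Qed.

(** The mixed-product rule of [*t], iterated over the qubits. *)
Lemma qubit_tens_mul T (f g : 'I_T -> 'M[R[i]]_2) :
  qubit_tens f *m qubit_tens g = qubit_tens (fun s => f s *m g s).
Proof.
elim: T f g => [|T IH] f g /=; first by rewrite mulmx1.
(* Destructing the size equation turns every [castmx] along it into the identity. *)
by rewrite -IH -tensmx_mul; case: _ / (esym (expnS 2 T)).
Qed.

Lemma qubit_tens_eq0 T (f : 'I_T -> 'M[R[i]]_2) r :
  f r = 0 -> qubit_tens f = 0.
Proof.
elim: T f r => [|T IH] f r /=; first by case: r.
move=> fr0; suff -> : f ord0 *t qubit_tens (fun s => f (lift ord0 s)) = 0.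
  by case: _ / (esym (expnS 2 T)).
case: (unliftP ord0 r) fr0 => [r'|] -> fr0; last by rewrite fr0 tens0mx.
by rewrite (IH (fun s => f (lift ord0 s)) r' fr0) tensmx0.
Qed.

(** Consider the hybrids with factors [g] before position [r] and [f] from [r] on. Consecutive
    hybrids differ only in factor [r], so by multilinearity their difference is the [r]-th
    summand. *)
Lemma qubit_tens_telescope T (f g : 'I_T -> 'M[R[i]]_2) :
  qubit_tens f - qubit_tens g =
  \sum_(r < T) qubit_tens (fun s =>
    if (s < r)%N then g s else if s == r then f r - g r else f s).
Proof.
elim: T f g => [|T IH] f g; first by rewrite big_ord0 subrr.
rewrite big_ord_recl /= -castmx_sum -tensmx_sumr.
set F := qubit_tens _; set G := qubit_tens (fun s => g (lift ord0 s)).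
(* All summands with nonzero [r] share the first factor [g ord0]; their tails sum to [F - G] by
   induction. *)
have -> : \sum_(r < T) qubit_tens (fun s : 'I_T =>
    if (lift ord0 s < lift ord0 r)%N then g (lift ord0 s) else
    if lift ord0 s == lift ord0 r then f (lift ord0 r) - g (lift ord0 r)
    else f (lift ord0 s)) = F - G.
  rewrite IH; apply: eq_bigr => r _; apply: eq_qubit_tens => s.
  by rewrite (inj_eq lift_inj).
(* What remains is [f ord0 *t F - g ord0 *t G], split by inserting [g ord0 *t F]. *)
rewrite tensmxBl tensmxBr; case: _ / (esym (expnS 2 T)) => /=.
by rewrite addrA subrK.
Qed.

Lemma mxcomm_qubit_tens T (f g : 'I_T -> 'M[R[i]]_2) :
  mxcomm (qubit_tens f) (qubit_tens g) =
  \sum_(r < T) qubit_tens (fun s =>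
    if (s < r)%N then g s *m f s
    else if s == r then mxcomm (f r) (g r)
    else f s *m g s).
Proof. by rewrite /mxcomm !qubit_tens_mul qubit_tens_telescope. Qed.

(** Each summand of the expansion contains one single-qubit commutator as a factor. The converse
    fails: XX and ZZ commute although X and Z do not. *)
Lemma mxcomm_qubit_tens_eq0 T (f g : 'I_T -> 'M[R[i]]_2) :
  (forall r, mxcomm (f r) (g r) = 0) ->
  mxcomm (qubit_tens f) (qubit_tens g) = 0.
Proof.
move=> fg0; rewrite mxcomm_qubit_tens big1 // => r _.
by apply: (qubit_tens_eq0 (r := r)); rewrite ltnn eqxx fg0.
Qed.

End QubitTensor.

(** On the outer systems each operator meets only an identity, so both products have outer factors
    [A] and [B] and differ in the mediator alone. *)
Lemma mxcomm_mediated (R : comPzRingType) m n p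
    (A : 'M[R]_m) (M N : 'M[R]_n) (B : 'M[R]_p) :
  mxcomm (A *t M *t 1%:M) (1%:M *t N *t B) = A *t mxcomm M N *t B.
Proof.
by rewrite /mxcomm !tensmx_mul !mul1mx !mulmx1 tensmxBr tensmxBl.
Qed.

Theorem mainTheorem3 (R : realType) (dA dB T : nat)
    (hT : (1 <= T)%N)
    (gA : 'I_(dA ^ 2).-1 -> 'M[R[i]]_dA) (hgA : su_generators gA)
    (gB : 'I_(dB ^ 2).-1 -> 'M[R[i]]_dB) (hgB : su_generators gB)
    (alpha : local_index dA -> mediator_index T -> R)
    (beta : mediator_index T -> local_index dB -> R)
    (H HAM HMB : 'M[R[i]]_(dA * 2 ^ T * dB))
    (hAM : HAM = \sum_(i : local_index dA) \sum_(j : mediator_index T)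
       (alpha i j)%:C *: (local_op gA i *t mediator_op R j *t (1%:M : 'M_dB)))
    (hMB : HMB = \sum_(l : mediator_index T) \sum_(k : local_index dB)
       (beta l k)%:C *: ((1%:M : 'M_dA) *t mediator_op R l *t local_op gB k))
    (hH : H = HAM + HMB) :
  mxcomm HAM HMB =
    \sum_(i : local_index dA) \sum_(j : mediator_index T)
      \sum_(l : mediator_index T) \sum_(k : local_index dB)
        ((alpha i j)%:C * (beta l k)%:C) *:
          (local_op gA i
           *t (\sum_(r < T) qubit_tens (fun s : 'I_T =>
                 if (s < r)%N then pauli R (l s) *m pauli R (j s)
                 else if s == r then mxcomm (pauli R (j r)) (pauli R (l r))
                 else pauli R (j s) *m pauli R (l s)))
           *t local_op gB k)
  /\
  (mxcomm HAM HMB != 0 ->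
     exists (i : local_index dA) (j l : mediator_index T)
            (k : local_index dB) (r : 'I_T),
       [/\ alpha i j != 0, beta l k != 0
         & mxcomm (pauli R (j r)) (pauli R (l r)) != 0]).
Proof.
(* Both claims follow from this form, where the mediator commutator is not yet split into qubits. *)
have comm_expansion : mxcomm HAM HMB =
    \sum_i \sum_j \sum_l \sum_k ((alpha i j)%:C * (beta l k)%:C) *:
      (local_op gA i *t mxcomm (mediator_op R j) (mediator_op R l)
       *t local_op gB k).
  rewrite hAM hMB mxcomm_suml; apply: eq_bigr => i _.
  rewrite mxcomm_suml; apply: eq_bigr => j _.
  rewrite mxcomm_sumr; apply: eq_bigr => l _.
  rewrite mxcomm_sumr; apply: eq_bigr => k _.
  by rewrite mxcommZ mxcomm_mediated.
split.
  rewrite comm_expansion; do 4!apply: eq_bigr => ? _.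
  by rewrite mxcomm_qubit_tens.
(* All index types are finite, so the existence of a witness is a boolean and can be decided by
   cases. *)
pose witness i j l k := [exists r : 'I_T, [&& alpha i j != 0, beta l k != 0
  & mxcomm (pauli R (j r)) (pauli R (l r)) != 0]].
have [/existsP[i /existsP[j /existsP[l /existsP[k /existsP[r /and3P[*]]]]]]|] :=
  boolP [exists i, exists j, exists l, exists k, witness i j l k].
  by exists i, j, l, k, r.
move=> no_witness; suff -> : mxcomm HAM HMB = 0 by rewrite eqxx.
rewrite comm_expansion.
apply: big1 => i _; apply: big1 => j _; apply: big1 => l _; apply: big1 => k _.
have [->|a0] := eqVneq (alpha i j) 0; first by rewrite mul0r scale0r.
have [->|b0] := eqVneq (beta l k) 0; first by rewrite mulr0 scale0r.
rewrite mxcomm_qubit_tens_eq0 ?tensmx0 ?tens0mx ?scaler0 // => r.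
(* Both coefficients are nonzero here, so a nonzero commutator at [r] would be a witness. *)
apply/eqP; apply: contraNT no_witness => c0.
apply/existsP; exists i; apply/existsP; exists j; apply/existsP; exists l.
by apply/existsP; exists k; apply/existsP; exists r; apply/and3P.
Qed.
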